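(* The following statements are true. (1) For all $m\geq 4$, the incentive ratio of the Kemeny rule $f_{\mathrm{Kemeny}}$ satisfies $\binom{m}{2}-m\leq\gamma_m(f_{\mathrm{Kemeny}})\leq\binom{m}{2}$. (2) For all $m\geq 3$, the incentive ratio of every distance scoring rule $f_{\mathrm{dist}}$ other than $f_{\mathrm{Kemeny}}$ satisfies $\binom{m}{2}-1\leq\gamma_m(f_{\mathrm{dist}})\leq\binom{m}{2}$. (3) For all $m\geq 3$, the incentive ratio of every positional scoring rule $f_{\mathrm{pos}}$ is $\gamma_m(f_{\mathrm{pos}})=\infty$.
   Context: Let $A$ be a set of $m$ alternatives. A ranking on $A$ is a complete, transitive, antisymmetric binary relation (linear order) on $A$; $\mathcal{R}$ is the set of all rankings. Comparisons $x\succ y$ are understood between distinct alternatives. The electorate is variable: a profile $R=(\succ_i)_{i\in N}$ assigns a ranking to each voter in some non-empty finite set $N$ of voters, where $N$ may be of any size, and the rules below are defined on all such profiles (a social welfare function, SWF, maps each profile to a single ranking). Kemeny distance: $\Delta(\succ,\rhd)=|\{(x,y)\in A^2: x\succ y\text{ and }y\rhd x\}|$. Tie-breaking: a ranking $>$ of the alternatives is fixed and extended lexicographically to rankings: for $\rhd_1=x_1\dots x_m$ and $\rhd_2=y_1\dots y_m$ (listed from best to worst), $\rhd_1>\rhd_2$ iff there is $\ell\in\{1,\dots,m\}$ with $x_\ell>y_\ell$ and $x_i=y_i$ for all $i<\ell$. Whenever several rankings are winning for one of the rules below, the rule selects the winning ranking that is most preferred with respect to $>$. Distance scoring rules: a distance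 scoring function is a function $s:\{0,\dots,\binom{m}{2}\}\to\mathbb{R}$ with $s(x)>s(x-1)$ for all $x\in\{1,\dots,\binom{m}{2}\}$ and $s(x)-s(x-1)\geq s(x-1)-s(x-2)$ for all $x\in\{2,\dots,\binom{m}{2}\}$. The distance scoring rule defined by $s$ chooses, for each profile $R$, the (lexicographically most preferred) ranking $\rhd$ minimizing $\sum_{i\in N}s(\Delta(\succ_i,\rhd))$. The Kemeny rule $f_{\mathrm{Kemeny}}$ is the distance scoring rule defined by $s(x)=x$. Positional scoring rules: let $r(\succ,x)=1+|\{y\in A\setminus\{x\}:y\succ x\}|$ be the rank of $x$ in $\succ$. A positional scoring function is a function $p:\{1,\dots,m\}\to\mathbb{R}$ with $p(1)\geq p(2)\geq\dots\geq p(m)$ and $p(1)>p(m)$. The positional scoring rule defined by $p$ returns for each profile $R$ the (lexicographically most preferred) ranking $\rhd$ such that $x\rhd y$ implies $\sum_{i\in N}p(r(\succ_i,x))\geq\sum_{i\in N}p(r(\succ_i,y))$. Incentive ratio: the utility of a voter with ranking $\succ_i$ for a ranking $\rhd$ is $u(\succ_i,\rhd)=\binom{m}{2}-\Delta(\succ_i,\rhd)$. The incentive ratio of an SWF $f$ for $m$ alternatives is $$\gamma_m(f)=\sup_{R,i,\succ_i'}\frac{u(\succ_i,f(\succ_i',R_{-i}))}{u(\succ_i,f(R))},$$ where the supremum is over all profiles $R$ on $m$ alternatives (with any non-empty finite set of voters $N$), all voters $i\in N$ (with ranking $\succ_i$ in $R$), and all rankings $\succ_i'\in\mathcal{R}$;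 $(\succ_i',R_{-i})$ is the profile obtained from $R$ by replacing voter $i$'s ranking with $\succ_i'$. Conventions: $\frac{x}{0}=\infty$ for $x>0$ and $\frac{0}{0}=1$. *)

(* Defs.v *)
(* MathComp / MathComp-Analysis *)
From HB Require Import structures.
From mathcomp Require Import all_boot all_order all_algebra.
From mathcomp Require Import all_classical all_reals ereal.

Set Implicit Arguments.
Unset Strict Implicit.
Unset Printing Implicit Defensive.

Import Order.TTheory GRing.Theory Num.Theory.
Local Open Scope ring_scope.

Definition is_ranking (A : finType) (r : {set A * A}) : bool :=
  [&& [forall x, forall y, ((x, y) \in r) || ((y, x) \in r)],
      [forall x, forall y, forall z,
         ((x, y) \in r) ==> ((y, z) \in r) ==> ((x, z) \in r)] &
      [forall x, forall y, ((x, y) \in r) ==> ((y, x) \in r) ==> (x == y)]].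

Record ranking (A : finType) : predArgType :=
  Ranking { ranking_rel : {set A * A}; ranking_axiom : is_ranking ranking_rel }.

HB.instance Definition _ (A : finType) := [isSub for @ranking_rel A].
HB.instance Definition _ (A : finType) := [Finite of ranking A by <:].

(* A ranking is complete, hence reflexive as a relation; comparisons are
   always between distinct alternatives. *)
Definition prefers (A : finType) (r : ranking A) : rel A :=
  fun x y => (x != y) && ((x, y) \in ranking_rel r).

Definition rank (A : finType) (r : ranking A) (x : A) : nat :=
  #|[set y | prefers r y x]|.+1.

Definition kendall (A : finType) (r q : ranking A) : nat :=
  #|[set xy : A * A | prefers r xy.1 xy.2 && prefers q xy.2 xy.1]|.

(* Voters may form any nonempty finite type, so the electorate is variable. *)
Record profile (A : finType) := Profile {
  voters : finType;
  voters_gt0 : (0 < #|voters|)%N;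
  pref : {ffun voters -> ranking A} }.

Definition deviate (A : finType) (P : profile A) (i : voters P)
    (q : ranking A) : profile A :=
  Profile (voters_gt0 P) [ffun j => if j == i then q else pref P j].

Definition swf (A : finType) := profile A -> ranking A.

(* [lex t r q]: at the first position l where the listings (best to worst) of
   r and q differ, t prefers r's entry x to q's entry y.  The i-th entry of a
   listing is the alternative of rank i. *)
Definition lex (A : finType) (t r q : ranking A) : bool :=
  [exists l : 'I_#|A|, exists x, exists y,
    [&& rank r x == l.+1, rank q y == l.+1, prefers t x y &
        [forall z, (rank r z < l.+1)%N ==> (rank q z == rank r z)]]].

(* [lex t] is a strict total order on rankings, so a nonempty W has exactly one
   such element; the default t is used only if W is empty, which does not
   happen for the sets of winning rankings below. *)
Definition lex_best (A : finType) (t : ranking A) (W : {set ranking A}) :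
    ranking A :=
  odflt t [pick r in W | [forall q in W, (q != r) ==> lex t r q]].

(* s and p are total functions on nat, constrained only on {0, ..., C(m, 2)}
   and {1, ..., m} respectively; the rules evaluate them only there. *)
Definition distance_scoring_function (R : realType) (m : nat)
    (s : nat -> R) : Prop :=
  (forall x, (1 <= x <= 'C(m, 2))%N -> s x > s (x - 1)%N) /\
  (forall x, (2 <= x <= 'C(m, 2))%N ->
     s x - s (x - 1)%N >= s (x - 1)%N - s (x - 2)%N).

Definition distance_cost (R : realType) (A : finType) (s : nat -> R)
    (P : profile A) (r : ranking A) : R :=
  \sum_(i : voters P) s (kendall (pref P i) r).

Definition distance_rule (R : realType) (A : finType) (t : ranking A)
    (s : nat -> R) : swf A :=
  fun P => lex_best t
    [set r | [forall q, distance_cost s P r <= distance_cost s P q]].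

Definition kemeny_rule (R : realType) (A : finType) (t : ranking A) : swf A :=
  distance_rule t (fun x : nat => x%:R : R).

Definition positional_scoring_function (R : realType) (m : nat)
    (p : nat -> R) : Prop :=
  (forall k, (1 <= k < m)%N -> p k >= p k.+1) /\ p 1%N > p m.

Definition positional_score (R : realType) (A : finType) (p : nat -> R)
    (P : profile A) (x : A) : R :=
  \sum_(i : voters P) p (rank (pref P i) x).

Definition positional_rule (R : realType) (A : finType) (t : ranking A)
    (p : nat -> R) : swf A :=
  fun P => lex_best t
    [set r | [forall x, forall y, prefers r x y ==>
       (positional_score p P x >= positional_score p P y)]].

Definition utility (R : realType) (A : finType) (r q : ranking A) : R :=
  'C(#|A|, 2)%:R - (kendall r q)%:R.

(* v / u with the conventions v / 0 = +oo for v > 0 and 0 / 0 = 1; utilities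
   are nonnegative. *)
Definition utility_ratio (R : realType) (v u : R) : \bar R :=
  if u == 0 then (if v == 0 then 1%:E else +oo%E) else (v / u)%:E.

Definition incentive_ratio (R : realType) (A : finType) (f : swf A) : \bar R :=
  ereal_sup [set g | exists (P : profile A) (i : voters P) (q : ranking A),
    g = utility_ratio (utility R (pref P i) (f (deviate i q)))
                      (utility R (pref P i) (f P))]%classic.

(* Main.v *)
(** For the Kemeny rule, t is viewed as an ordering of the vertices of a path whose
    m - 1 edges are the only pairs on which t and a second ranking w agree.  Since
    the complement of a path on at least four vertices has only two transitive
    orientations, suitable Condorcet triples make t and w the only Kemeny optima;
    t then wins by tie-breaking, and a voter at distance m from w obtains w by
    reporting it.  For other distance scoring rules, strict convexity does the
    same for t and its reversal.  For positional rules all alternatives are tied,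
    and a voter ranking exactly opposite to t breaks one of the ties.  The upper
    bound holds because a voter with utility 0 cannot change the outcome. *)
Require Import Defs.
From mathcomp Require Import all_boot all_order all_algebra perm.
From mathcomp Require Import all_classical all_reals ereal.
From mathcomp Require Import zify ring lra.

Import Order.TTheory GRing.Theory Num.Theory.
Local Open Scope ring_scope.

(** * Rankings as strict linear orders *)

Section Rankings.
Context {A : finType}.
Implicit Types (r q t : ranking A) (x y z : A).

Lemma prefers_irr r x : prefers r x x = false.
Proof. by rewrite /prefers eqxx. Qed.

Lemma prefers_trans r : transitive (prefers r).
Proof.
move=> y x z; case: r => e /=; rewrite /prefers /= => he.
case/and3P: (he) => _ /forallP tr /forallP asym.
move=> /andP[xy exy] /andP[yz eyz].
have exz := implyP (implyP (forallP (forallP (tr x) y) z) exy) eyz.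
rewrite exz andbT; apply: contraNneq xy => xz; rewrite xz in exy *.
exact: (implyP (implyP (forallP (asym z) y) exy) eyz).
Qed.

Lemma prefersN r x y : x != y -> prefers r y x = ~~ prefers r x y.
Proof.
case: r => e; rewrite /prefers /= eq_sym => he xy; rewrite xy /=.
case/and3P: (he) => /forallP tot _ /forallP asym.
have := forallP (tot x) y; case exy: ((x, y) \in e); last by [].
move=> _.
apply: contraNF xy => eyx; rewrite eq_sym.
exact: (implyP (implyP (forallP (asym x) y) exy) eyx).
Qed.

Lemma prefers_neq r x y : prefers r x y -> x != y.
Proof. by case/andP. Qed.

Lemma prefers_asym r x y : prefers r x y -> prefers r y x = false.
Proof. by move=> h; rewrite prefersN ?h // (prefers_neq _ _ _ h). Qed.

(** A strict total order has no room to grow, so one inclusion is enough; the diagonal, invisible to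
    [prefers], is settled by reflexivity. *)
Lemma ranking_ext r q :
  (forall x y, prefers r x y -> prefers q x y) -> r = q.
Proof.
move=> h; apply: val_inj; apply/setP => -[x y].
have refl (p : ranking A) z : (z, z) \in val p.
  case: p => e /= /[dup] he /and3P[/forallP tot _ _].
  by have := forallP (tot z) z; rewrite orbb.
have [->|xy] := eqVneq x y; first by rewrite !refl.
have E (p : ranking A) : ((x, y) \in val p) = prefers p x y.
  by rewrite /prefers xy.
rewrite !E; case rxy: (prefers r x y); first by rewrite (h _ _ rxy).
have := prefersN r _ _ xy; rewrite rxy => /h; rewrite (prefersN q _ _ xy).
by move/negbTE.
Qed.

Lemma key_axiom (k : A -> nat) :
  injective k -> is_ranking [set xy : A * A | (k xy.1 <= k xy.2)%N].
Proof.
move=> kI; apply/and3P; split; apply/forallP => x; apply/forallP => y.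
- by rewrite !inE /= leq_total.
- apply/forallP => z; rewrite !inE /=; apply/implyP => h; apply/implyP.
  exact: leq_trans.
rewrite !inE /=; apply/implyP => h1; apply/implyP => h2.
by apply/eqP/kI/eqP; rewrite eqn_leq h1.
Qed.

(** Smaller keys are better. All explicit rankings below come from such keys, which reduces their
    comparisons to arithmetic. *)
Definition key_ranking (k : A -> nat) (kI : injective k) : ranking A :=
  Ranking (key_axiom k kI).

Lemma prefers_key (k : A -> nat) (kI : injective k) x y :
  prefers (key_ranking k kI) x y = (k x < k y)%N.
Proof.
by rewrite /prefers inE /= ltn_neqAle (inj_eq kI).
Qed.

Lemma rank_lt r x y : prefers r x y -> (rank r x < rank r y)%N.
Proof.
move=> xy; rewrite /rank ltnS; apply/proper_card/properP; split.
  by apply/fintype.subsetP => z; rewrite !inE => zx; apply: prefers_trans xy.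
by exists x; rewrite !inE ?prefers_irr.
Qed.

Lemma ltn_rank r x y : (rank r x < rank r y)%N = prefers r x y.
Proof.
have [->|xy] := eqVneq x y; first by rewrite ltnn prefers_irr.
case h: (prefers r x y); first exact: rank_lt.
have := prefersN r _ _ xy; rewrite h => /rank_lt h'.
by rewrite ltnNge (ltnW h').
Qed.

Lemma rank_inj r : injective (rank r).
Proof.
move=> x y e; apply/eqP/negPn/negP => xy.
by have := prefersN r _ _ xy; rewrite -!ltn_rank e ltnn.
Qed.

Lemma rank_leq r x : (rank r x <= #|A|)%N.
Proof.
rewrite /rank -cardsT; apply/proper_card/properP; split.
  exact: finset.subsetT.
by exists x; rewrite !inE // prefers_irr.
Qed.

Lemma rank_bounds r x : (0 < rank r x <= #|A|)%N.
Proof. exact: rank_leq. Qed.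

Lemma rank_surj r k : (0 < k <= #|A|)%N -> exists x, rank r x = k.
Proof.
case: k => // k /= kA.
pose f x : 'I_#|A| := Ordinal (rank_leq r x : (rank r x).-1 < _)%N.
have fI : injective f.
  by move=> x y /(congr1 val) /= e; apply: (rank_inj r); rewrite /rank; congr _.+1.
have [g _ gK] := inj_card_bij fI (eq_leq (card_ord _)).
exists (g (Ordinal kA)); have := congr1 val (gK (Ordinal kA)) => /= e.
exact: (congr1 S e).
Qed.

Lemma rank_ext r q : (forall x, rank r x = rank q x) -> r = q.
Proof. by move=> h; apply: ranking_ext => x y; rewrite -!ltn_rank !h. Qed.

Definition rev_ranking r : ranking A.
Proof.
refine (key_ranking (fun x => #|A| - rank r x)%N _).
move=> x y e; apply: (rank_inj r).
by have := rank_leq r x; have := rank_leq r y; lia.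
Defined.

Lemma prefers_rev r x y : prefers (rev_ranking r) x y = prefers r y x.
Proof.
rewrite prefers_key -ltn_rank.
have := rank_leq r x; have := rank_leq r y; lia.
Qed.

Lemma rev_rankingK : involutive rev_ranking.
Proof. by move=> r; apply: ranking_ext => x y; rewrite !prefers_rev. Qed.

(** * Lexicographic tie-breaking *)

Lemma lexP t r q :
  reflect (exists x y, [/\ rank q y = rank r x, prefers t x y &
             forall z, (rank r z < rank r x)%N -> rank q z = rank r z])
    (lex t r q).
Proof.
apply: (iffP existsP) => [[l /existsP[x /existsP[y /and4P[]]]]|[x [y [e p h]]]].
  move=> /eqP rx /eqP ry p /forallP h; exists x, y; split => //; first by rewrite rx.
  by move=> z; rewrite rx => lz; apply/eqP; apply: implyP (h z) _.
exists (Ordinal (rank_leq r x : (rank r x).-1 < _)%N).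
apply/existsP; exists x; apply/existsP; exists y; rewrite /= eqxx p e eqxx /=.
by apply/forallP => z; apply/implyP => /h ->.
Qed.

Lemma lex_irr t r : lex t r r = false.
Proof. by apply/lexP => -[x [y [/rank_inj ->]]]; rewrite prefers_irr. Qed.

Lemma lex_trans t : transitive (lex t).
Proof.
move=> q r w /lexP[x [y [e p h]]] /lexP[x' [y' [e' p' h']]]; apply/lexP.
(* The earlier of the two first differences decides between [r] and [w]; if they coincide,
   transitivity of [t] does. *)
case: (ltngtP (rank r x) (rank q x')) => c.
- exists x, y; split=> // [|z zx]; first by rewrite -e h' ?e.
  by have hz := h _ zx; rewrite h' hz // (ltn_trans zx).
- have [u ru] := rank_surj r (rank q x') (rank_bounds q x').
  have ux' : u = x' by apply: (rank_inj q); rewrite h // ru.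
  rewrite ux' in ru; exists x', y'; rewrite ru; split => // z zx.
  by have hz := h _ (ltn_trans zx c); rewrite h' hz.
have yx' : y = x' by apply: (rank_inj q); rewrite e.
exists x, y'; split; [by rewrite e' -c|by apply: prefers_trans p'; rewrite -yx'|].
by move=> z zx; have hz := h _ zx; rewrite h' hz // -c.
Qed.

Lemma lex_total t r q : r != q -> lex t r q || lex t q r.
Proof.
move=> rq; have [x0 hx0] : exists x, rank r x != rank q x.
  apply/existsP; rewrite -negb_forall; apply: contra rq => /forallP h.
  by apply/eqP/rank_ext => x; apply/eqP.
(* Minimality in [r] makes the rank of [x] the first position at which the listings differ. *)
have [x hx hmin] := @arg_minnP _ x0 (fun x => rank r x != rank q x) (rank r) hx0.
have [y ey] := rank_surj q (rank r x) (rank_bounds r x).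
have xy : x != y by apply: contraNneq hx => xy; rewrite -ey xy.
have hr z : (rank r z < rank r x)%N -> rank q z = rank r z.
  move=> zx; apply/eqP; rewrite eq_sym; apply: contraTT zx => /hmin.
  by rewrite -leqNgt.
have hq z : (rank q z < rank q y)%N -> rank r z = rank q z.
  rewrite ey => zx.
  have [u ru] := rank_surj r (rank q z) (rank_bounds q z).
  have uz : u = z by apply: (rank_inj q); rewrite hr ru.
  by rewrite -uz ru uz.
case p: (prefers t x y); apply/orP; [left|right]; apply/lexP.
  by exists x, y.
by exists y, x; split => //; rewrite prefersN ?p.
Qed.

(** A first difference in favour of [q] would be an alternative that [t] lists earlier, where both
    listings still agree. *)
Lemma lex_top t q : q != t -> lex t t q.
Proof.
move=> qt; have := lex_total t t q; rewrite eq_sym qt => /(_ isT).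
case/orP => // /lexP[x [y [e p h]]].
have tx : (rank t x < rank q x)%N by rewrite -e ltn_rank.
have [u qu] := rank_surj q (rank t x) (rank_bounds t x).
have ux : u = x by apply: (rank_inj t); rewrite h qu.
by move: tx; rewrite -qu ux ltnn.
Qed.

Lemma lex_best_uniq t (W : {set ranking A}) r :
  r \in W -> (forall q, q \in W -> q != r -> lex t r q) -> lex_best t W = r.
Proof.
move=> rW h; rewrite /lex_best; case: pickP => [p /andP[pW /forallP hp]|/(_ r)] /=.
  apply/eqP/negPn/negP => pr.
  have := implyP (implyP (hp r) rW); rewrite eq_sym => /(_ pr) l1.
  by have := lex_trans t _ _ _ l1 (h _ pW pr); rewrite lex_irr.
rewrite rW => /negP[]; apply/forallP => q; apply/implyP => qW; apply/implyP.
exact: h.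
Qed.

Lemma lex_bestP t (W : {set ranking A}) r0 : r0 \in W ->
  lex_best t W \in W /\ forall q, q \in W -> q != lex_best t W -> lex t (lex_best t W) q.
Proof.
move=> r0W; pose n r := #|[set q in W | lex t r q]|.
(* [r] beats the most elements of [W]; one that beat [r] would, by transitivity, beat strictly
   more. *)
have [r rW hr] := @arg_maxnP _ r0 (fun r => r \in W) n r0W.
have hbest q : q \in W -> q != r -> lex t r q.
  move=> qW qr; have := lex_total t r q; rewrite eq_sym qr => /(_ isT)/orP[//|lqr].
  have : (n q <= n r)%N := hr q qW; rewrite leqNgt => /negP[]; apply: proper_card; apply/properP; split.
    apply/fintype.subsetP => z; rewrite !inE => /andP[-> ] /=.
    exact: lex_trans lqr.
  by exists r; rewrite !inE ?rW ?lex_irr.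
by rewrite (lex_best_uniq _ _ _ rW hbest).
Qed.

Lemma lex_best_top t (W : {set ranking A}) : t \in W -> lex_best t W = t.
Proof. by move=> tW; apply: lex_best_uniq => // q _; apply: lex_top. Qed.

(** * Kendall distance *)

Definition discord r q := [set xy : A * A | prefers r xy.1 xy.2 && prefers q xy.2 xy.1].

Lemma swap_inj : injective (fun u : A * A => (u.2, u.1)).
Proof. by move=> [a b] [c d] [-> ->]. Qed.

Lemma kendallC r q : kendall r q = kendall q r.
Proof.
rewrite /kendall -(card_imset _ swap_inj).
apply: eq_card => -[x y]; rewrite [in RHS]inE /= andbC.
apply/imsetP/idP => [[[u v]]|h].
  by rewrite inE /= => h [-> ->].
by exists (y, x); rewrite ?inE.
Qed.

(** The pairs ordered by [r] and their mirror images are equally many and together exhaust the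
    off-diagonal pairs. *)
Lemma card_prefers r : #|[set xy : A * A | prefers r xy.1 xy.2]| = 'C(#|A|, 2).
Proof.
set S := [set _ | _]; pose S' := [set xy : A * A | prefers r xy.2 xy.1].
have SS' : #|S'| = #|S|.
  rewrite -(card_imset (mem S) swap_inj).
  apply: eq_card => -[x y]; rewrite inE /=; apply/idP/imsetP => [h|[[u v]]].
    by exists (y, x); rewrite ?inE.
  by rewrite inE /= => h [-> ->].
have dSS' : [disjoint S & S'].
  apply/pred0P => -[x y] /=; rewrite !inE /=.
  by apply/andP => -[/prefers_asym ->].
have tot : S :|: S' = ~: [set xy : A * A | xy.1 == xy.2].
  apply/setP => -[x y]; rewrite !inE /=.
  have [->|xy] := eqVneq x y; first by rewrite prefers_irr.
  by rewrite (prefersN r x y xy) orbN.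
have diag : #|[set xy : A * A | xy.1 == xy.2]| = #|A|.
  rewrite -cardsT -(card_imset (mem [set: A]) (_ : injective (fun x => (x, x)))); last first.
    by move=> x y [].
  apply: eq_card => -[x y]; rewrite inE /=; apply/eqP/imsetP => [->|[z _ [-> ->]//]].
  by exists y; rewrite ?inE.
have := cardsUI S S'; rewrite tot (_ : S :&: S' = finset.set0); last first.
  by apply/eqP; rewrite finset.setI_eq0.
rewrite cards0 SS' addn0 cardsCs finset.setCK diag card_prod => h.
by rewrite bin2 -subn1 mulnBr muln1 h addnn doubleK.
Qed.

(** Each comparison of [r] is contradicted by exactly one of [q] and its reversal. *)
Lemma kendall_rev r q : (kendall r q + kendall r (rev_ranking q))%N = 'C(#|A|, 2).
Proof.
rewrite /kendall -cardsUI -(card_prefers r).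
rewrite (_ : _ :&: _ = finset.set0); last first.
  apply/setP => -[x y]; rewrite !inE /= prefers_rev.
  by apply/negP => /andP[/andP[_ h] /andP[_]]; rewrite (prefers_asym _ _ _ h).
rewrite cards0 addn0; apply: eq_card => -[x y]; rewrite !inE /= prefers_rev -andb_orr.
apply: andb_idr => /prefers_neq xy; rewrite (prefersN q x y xy); exact: orNb.
Qed.

Lemma kendall_triangle p r q : (kendall r q <= kendall r p + kendall p q)%N.
Proof.
rewrite -cardsUI (leq_trans _ (leq_addr _ _)) //; apply: subset_leq_card.
apply/fintype.subsetP => -[x y]; rewrite !inE /= => /andP[rxy ->]; rewrite rxy andbT /=.
by rewrite (prefersN p x y (prefers_neq _ _ _ rxy)) orNb.
Qed.

Lemma kendall_eq0 r q : (kendall r q == 0)%N = (r == q).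
Proof.
apply/idP/eqP => [|->].
  rewrite cards_eq0 => /eqP/setP h; apply: ranking_ext => x y rxy.
  have := h (x, y); rewrite !inE /= rxy /= (prefersN q x y (prefers_neq _ _ _ rxy)).
  by move/negbFE.
rewrite cards_eq0; apply/eqP/setP => -[x y]; rewrite !inE /=.
by apply/negP => /andP[/prefers_asym ->].
Qed.

Lemma kendallxx r : kendall r r = 0%N.
Proof. by apply/eqP; rewrite kendall_eq0. Qed.

Lemma kendall_revr r q : kendall r (rev_ranking q) = ('C(#|A|, 2) - kendall r q)%N.
Proof. by rewrite -(kendall_rev r q) addKn. Qed.

Lemma kendall_revl r q : kendall (rev_ranking r) q = ('C(#|A|, 2) - kendall r q)%N.
Proof. by rewrite kendallC kendall_revr kendallC. Qed.

Lemma kendall_leq r q : (kendall r q <= 'C(#|A|, 2))%N.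
Proof. by rewrite -(kendall_rev r q) leq_addr. Qed.

Lemma kendall_eq_max r q : (kendall r q == 'C(#|A|, 2)) = (q == rev_ranking r).
Proof.
rewrite -[q == _](inj_eq (can_inj rev_rankingK)) rev_rankingK -kendall_eq0.
by rewrite kendall_revl (kendallC q r); have := kendall_leq r q; lia.
Qed.

(* The two rankings differ by one transposition of adjacent alternatives. *)
Lemma kendall_swap p r q x y : discord p r = [set (x, y)] -> prefers q y x ->
  kendall p q = (kendall r q).+1.
Proof.
move=> /setP h qyx.
have pxy : prefers p x y by have := h (x, y); rewrite !inE eqxx => /andP[].
have ryx : prefers r y x by have := h (x, y); rewrite !inE eqxx => /andP[].
have same u v : (u, v) != (x, y) -> (v, u) != (x, y) -> prefers p u v = prefers r u v.
  move=> n1 n2; have := h (u, v); have := h (v, u); rewrite !inE (negbTE n1) (negbTE n2) /=.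
  have [->|uv] := eqVneq u v; first by rewrite !prefers_irr.
  by rewrite !(prefersN _ u v uv); do 2!case: (prefers _ u v).
suff -> : kendall p q = #|(x, y) |: discord r q|.
  by rewrite cardsU1 inE /= (prefers_asym _ _ _ ryx).
apply: eq_card => -[u v]; rewrite !inE /=.
have [[-> ->]|n1] /= := eqVneq (u, v) (x, y); first by rewrite pxy qyx.
have [[-> ->]|n2] := eqVneq (v, u) (x, y); last by rewrite same.
by rewrite (prefers_asym _ _ _ qyx) !andbF.
Qed.

Lemma card_discord r q : #|discord r q| = kendall r q. Proof. by []. Qed.

End Rankings.

(** * Profiles, utilities and distance rules *)

Section Rules.
Context {R : realType} {A : finType}.
Implicit Types (r q t : ranking A) (P : profile A).

(** Costs and scores are sums over the votes, so a list of votes says all that is needed of a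
    profile; its head is the manipulator. *)
Lemma list_profile r (s : seq (ranking A)) :
  exists (P : profile A) (i : voters P), [/\ pref P i = r,
    forall F : ranking A -> R, \sum_j F (pref P j) = \sum_(x <- r :: s) F x &
    forall q (F : ranking A -> R),
      \sum_j F (pref (deviate i q) j) = \sum_(x <- q :: s) F x].
Proof.
have card_gt0 : (0 < #|'I_(size s).+1|)%N by rewrite card_ord.
pose P := Profile card_gt0 [ffun j : 'I_(size s).+1 => nth r (r :: s) j].
have sumP F : \sum_(j < size s) F (nth r s j) = \sum_(x <- s) F x :> R.
  by rewrite (big_nth r) big_mkord.
exists P, ord0; split=> [|F|q F]; rewrite /= ?ffunE //.
  by rewrite big_cons big_ord_recl /= ffunE -sumP; under eq_bigr do rewrite ffunE.
rewrite big_cons big_ord_recl /= ffunE eqxx -sumP; congr (_ + _).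
by apply: eq_bigr => j _; rewrite !ffunE.
Qed.

Lemma incentive_ratio_ge (f : swf A) P (i : voters P) q :
  (utility_ratio (utility R (pref P i) (f (deviate i q)))
                 (utility R (pref P i) (f P)) <= incentive_ratio R f)%E.
Proof. by apply: ereal_sup_ubound; exists P, i, q. Qed.

Lemma utilityE r q : utility R r q = (kendall (rev_ranking r) q)%:R.
Proof. by rewrite kendall_revl natrB // kendall_leq. Qed.

Lemma utility_revl r q : utility R (rev_ranking r) q = (kendall r q)%:R.
Proof. by rewrite utilityE rev_rankingK. Qed.

Lemma utility_ge0 r q : 0 <= utility R r q.
Proof. by rewrite utilityE ler0n. Qed.

Lemma utility_le r q : utility R r q <= 'C(#|A|, 2)%:R.
Proof. by rewrite utilityE ler_nat kendall_leq. Qed.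

Lemma utility_eq0 r q : (utility R r q == 0) = (q == rev_ranking r).
Proof. by rewrite utilityE pnatr_eq0 kendall_eq0 eq_sym. Qed.

Lemma distance_ruleP t (s : nat -> R) P :
  (forall q, distance_cost s P (distance_rule t s P) <= distance_cost s P q) /\
  (forall q, distance_cost s P q <= distance_cost s P (distance_rule t s P) ->
     q != distance_rule t s P -> lex t (distance_rule t s P) q).
Proof.
pose c := distance_cost s P.
have [r0 _ hr0] := @arg_minP _ _ _ t predT c isT.
have r0W : r0 \in [set r | [forall q, c r <= c q]].
  by rewrite inE; apply/forallP => q; apply: hr0.
have [] := lex_bestP t _ _ r0W; rewrite -[lex_best _ _]/(distance_rule t s P).
rewrite inE => /forallP hW hl; split=> // q cq; apply: hl.
by rewrite inE; apply/forallP => q'; apply: le_trans cq _.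
Qed.

Lemma distance_rule_eq t (s : nat -> R) P r :
  (forall q, distance_cost s P r <= distance_cost s P q) ->
  (forall q, distance_cost s P q <= distance_cost s P r -> q != r -> lex t r q) ->
  distance_rule t s P = r.
Proof.
move=> hr hl; apply: lex_best_uniq; first by rewrite inE; apply/forallP.
by move=> q; rewrite inE => /forallP hq; apply: hl.
Qed.

Lemma distance_rule_top t (s : nat -> R) P :
  (forall q, distance_cost s P t <= distance_cost s P q) -> distance_rule t s P = t.
Proof. by move=> h; apply: distance_rule_eq => // q _; apply: lex_top. Qed.

Lemma distance_rule_strict t (s : nat -> R) P r :
  (forall q, q != r -> distance_cost s P r < distance_cost s P q) ->
  distance_rule t s P = r.
Proof.
move=> h; apply: distance_rule_eq => q.
  by have [->//|/h/ltW] := eqVneq q r.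
by move=> cq /h; rewrite ltNge cq.
Qed.

Lemma distance_cost_deviate (s : nat -> R) P (i : voters P) q r :
  distance_cost s (deviate i q) r + s (kendall (pref P i) r) =
  distance_cost s P r + s (kendall q r).
Proof.
rewrite /distance_cost (bigD1 i) //= [in RHS](bigD1 i) //= ffunE eqxx.
rewrite (eq_bigr (fun j => s (kendall (pref P j) r))); first ring.
by move=> j /negbTE ji; rewrite ffunE ji.
Qed.

(** * Convexity of distance scores *)

Section Convexity.
Variables (m : nat) (s : nat -> R).
Hypothesis s_dist : distance_scoring_function m s.

Lemma score_increment_le i j : (i <= j < 'C(m, 2))%N ->
  s i.+1 - s i <= s j.+1 - s j.
Proof.
case: s_dist => _ conv; elim: j => [|j IH]; first by case: i.
case/andP; rewrite leq_eqVlt => /orP[/eqP->//|ij] jM.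
apply: le_trans (IH _) _; first by rewrite -ltnS ij ltnW.
have := conv j.+2; rewrite subn1 subn2 /=; apply; lia.
Qed.

Lemma score_lt i j : (i < j <= 'C(m, 2))%N -> s i < s j.
Proof.
case: s_dist => inc _; elim: j => [|j IH]; first by [].
case/andP; rewrite ltnS leq_eqVlt => ij jM.
have sj : s j < s j.+1 by have := inc j.+1; rewrite subn1; apply; lia.
case/orP: ij => [/eqP->//|ij]; apply: lt_trans (IH _) sj.
by rewrite ij ltnW.
Qed.

Lemma score_le i j : (i <= j <= 'C(m, 2))%N -> s i <= s j.
Proof.
case/andP; rewrite leq_eqVlt => /orP[/eqP->//|ij] jM.
by apply/ltW/score_lt/andP.
Qed.

Lemma score_convex i j k : (i <= j)%N -> (j + k <= 'C(m, 2))%N ->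
  s (i + k)%N - s i <= s (j + k)%N - s j.
Proof.
move=> ij; elim: k => [|k IH] jk; first by rewrite !addn0 !subrr.
have h1 : s (i + k)%N - s i <= s (j + k)%N - s j by apply: IH; lia.
have h2 : s (i + k).+1 - s (i + k)%N <= s (j + k).+1 - s (j + k)%N.
  by apply: score_increment_le; lia.
by rewrite !addnS; lra.
Qed.

(* Otherwise the increments s (j + 1) - s j would be constant on each interval
   [j, j + M - d], where M = C(m, 2); for 0 < d < M these overlap. *)
Lemma score_strict d : s 1%N - s 0%N < s 'C(m, 2) - s 'C(m, 2).-1 ->
  (0 < d < 'C(m, 2))%N -> s d + s ('C(m, 2) - d)%N < s 0%N + s 'C(m, 2).
Proof.
set M := 'C(m, 2) => sM /andP[d_gt0 dM]; rewrite ltNge; apply/negP => le_d.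
pose g j := s j.+1 - s j.
have g_sum a k : s (a + k)%N - s a = \sum_(i < k) g (a + i)%N.
  elim: k => [|k IH]; first by rewrite addn0 subrr big_ord0.
  by rewrite big_ord_recr /= -IH /g addnS; ring.
have g_le i j : (i <= j < M)%N -> g i <= g j := score_increment_le i j.
(* The last [d] increments sum to [s M - s (M - d)] and dominate the first [d] termwise; [le_d] says
   that their sum is no larger than that of the first, so all terms agree. *)
have eq_g (i : 'I_d) : g (M - d + i)%N - g i = 0.
  have nneg (l : 'I_d) : true -> 0 <= g (M - d + l)%N - g l.
    by move=> _; rewrite subr_ge0 g_le //; have := ltn_ord l; lia.
  have sum0 : \sum_(l < d) (g (M - d + l)%N - g l) = 0.
    apply/eqP; rewrite eq_le sumr_ge0 // andbT big_split sumrN /= -g_sum.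
    under eq_bigr do rewrite -[X in g X]add0n; rewrite -g_sum subnK ?(ltnW dM) //.
    by rewrite add0n; lra.
  exact: psumr_eq0P nneg sum0 i isT.
have gc j : (j < M)%N -> g j = g 0%N.
  (* Up to [M - d], monotonicity squeezes [g j] between two equal increments; beyond, shift back by
     [M - d]. *)
  elim/ltn_ind: j => j IH jM; have [jd|jd] := leqP j (M - d).
    have := eq_g (Ordinal d_gt0); rewrite /= addn0 => /subr0_eq g0.
    apply/eqP; rewrite eq_le (g_le 0%N j) ?jM // andbT -g0 g_le // jd; lia.
  have lt : (j - (M - d) < d)%N by lia.
  have := eq_g (Ordinal lt); rewrite /= subnKC ?(ltnW jd) // => /subr0_eq ->.
  by apply: IH; lia.
have := gc M.-1; rewrite /g prednK; last lia.
by move=> gM; move: sM; rewrite gM ?ltxx //; lia.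
Qed.

(** Convexity puts every increment between the first and the last, so all are equal once the last is
    at most the first. *)
Lemma score_affine x : s 'C(m, 2) - s 'C(m, 2).-1 <= s 1%N - s 0%N ->
  (x <= 'C(m, 2))%N -> s x = s 0%N + x%:R * (s 1%N - s 0%N).
Proof.
move=> hM; elim: x => [|x IH] xM; first by rewrite mul0r addr0.
have hx : s x.+1 - s x = s 1%N - s 0%N.
  apply: le_anti; rewrite (score_increment_le 0 x) // andbT.
  apply: le_trans hM; have := score_increment_le x 'C(m, 2).-1.
  by rewrite prednK; [apply; lia | lia].
by rewrite -[s x.+1](subrK (s x)) hx IH 1?ltnW // -natr1; ring.
Qed.

End Convexity.

(* If the winner r is the reversal of voter i's ranking, no deviation changes
   the winner: moving from r to q at distance e lowers the cost of the deviating
   vote by at most s M - s (M - e), which is what voter i already contributed. *)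
Lemma distance_rule_rev t (s : nat -> R) P (i : voters P) q' :
  distance_scoring_function #|A| s ->
  distance_rule t s P = rev_ranking (pref P i) ->
  distance_rule t s (deviate i q') = rev_ranking (pref P i).
Proof.
move=> sd fP; set r := rev_ranking _ in fP *.
have [le_r lex_r] := distance_ruleP t s P; rewrite fP in le_r lex_r.
have key q : s (kendall q' r) - s (kendall q' q) <=
    s (kendall (pref P i) r) - s (kendall (pref P i) q).
  rewrite [kendall (pref P i) r]kendall_revr kendallxx subn0.
  have e : kendall (pref P i) q = ('C(#|A|, 2) - kendall r q)%N.
    by rewrite -(rev_rankingK (pref P i)) kendall_revl.
  have := kendall_triangle q q' r; rewrite e.
  have := kendall_leq r q; have := kendall_leq q' r; have := kendall_leq q' q.
  rewrite (kendallC q r).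
  move: (kendall q' r) (kendall r q) (kendall q' q) => a d b bM aM dM tri.
  (* The subtraction is truncated: for [a <= d] convexity is applied from 0, otherwise from
     [a - d]. *)
  have hb : s (a - d)%N <= s b by apply: (score_le _ _ sd); lia.
  have [ad|da] := leqP a d.
    have ha : s a <= s d by apply: (score_le _ _ sd); rewrite ad.
    have := score_convex _ _ sd 0 ('C(#|A|, 2) - d) d.
    rewrite add0n subnK // leq0n leqnn => /(_ isT isT).
    by move: hb; rewrite (eqP ad); lra.
  have := score_convex _ _ sd (a - d) ('C(#|A|, 2) - d) d.
  rewrite !subnK ?(ltnW da) // leqnn leq_sub2r // => /(_ isT isT).
  by lra.
have costE q := distance_cost_deviate s P i q' q.
apply: distance_rule_eq => [q|q cq qr].
  by have := costE q; have := costE r; have := key q; have := le_r q; lra.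
apply: lex_r => //.
by have := costE q; have := costE r; have := key q; lra.
Qed.

(** A truthful utility of 0 stays 0 after any deviation, and 0/0 counts as 1. Otherwise the
    denominator is a positive natural number, hence at least 1. *)
Lemma distance_incentive_le t (s : nat -> R) :
  distance_scoring_function #|A| s -> (2 <= #|A|)%N ->
  (incentive_ratio R (distance_rule t s) <= ('C(#|A|, 2)%:R)%:E)%E.
Proof.
move=> sd m2; apply: ub_ereal_sup => _ [P [i [q ->]]].
rewrite /utility_ratio; case: ifP => [|u0].
  rewrite utility_eq0 => /eqP/distance_rule_rev->//.
  by rewrite ?eqxx (_ : utility _ _ _ == 0) ?utility_eq0 // lee_fin ler1n bin_gt0.
rewrite lee_fin ler_pdivrMr; last by rewrite lt_def u0 utility_ge0.
apply: le_trans (utility_le _ _) _; rewrite ler_peMr ?ler0n //.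
by move: u0; rewrite utilityE pnatr_eq0 ler1n lt0n => ->.
Qed.

End Rules.

(** * Relabelling the alternatives *)

Section Relabelling.
Context {A : finType}.
Implicit Types (r q t : ranking A) (x y z : A).

(** The pull-back of [r] along [f]. This symmetry makes sums over all rankings independent of the
    reference ranking or alternative. *)
Definition relabel (f : A -> A) (fI : injective f) r : ranking A :=
  key_ranking (fun x => rank r (f x)) (inj_comp (rank_inj r) fI).

Variables (f : A -> A) (fI : injective f).

Lemma prefers_relabel r x y : prefers (relabel f fI r) x y = prefers r (f x) (f y).
Proof. by rewrite prefers_key ltn_rank. Qed.

Lemma rank_relabel r x : rank (relabel f fI r) x = rank r (f x).
Proof.
congr _.+1; rewrite -[RHS](on_card_preimset (f := f)); last exact/onW_bij/injF_bij.
by apply: eq_card => y; rewrite !inE prefers_relabel.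
Qed.

Lemma kendall_relabel r q : kendall (relabel f fI r) (relabel f fI q) = kendall r q.
Proof.
pose g (u : A * A) := (f u.1, f u.2).
have gI : injective g by move=> [a b] [c d] [/fI-> /fI->].
rewrite /kendall -[RHS](on_card_preimset (f := g)); last exact/onW_bij/injF_bij.
by apply: eq_card => -[x y]; rewrite !inE /= !prefers_relabel.
Qed.

Lemma relabel_bij : bijective (relabel f fI).
Proof.
apply: injF_bij => r q e; have fb := injF_bij fI.
case: fb => g _ fK; apply: rank_ext => x.
by rewrite -(fK x) -!rank_relabel e.
Qed.

End Relabelling.

Lemma sum_rankings_kendall (R : realType) (A : finType) (s : nat -> R) (q q' : ranking A) :
  \sum_r s (kendall r q) = \sum_r s (kendall r q').
Proof.
have ex x : exists y, rank q' y == rank q x.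
  by have [y] := rank_surj q' (rank q x) (rank_bounds q x); exists y; apply/eqP.
(* [f] sends each alternative of [q] to the one at the same position in [q']. *)
pose f x := xchoose (ex x); have fE x : rank q' (f x) = rank q x.
  exact/eqP/(xchooseP (ex x)).
have fI : injective f by move=> x y e; apply: (rank_inj q); rewrite -!fE e.
have -> : q = relabel f fI q' by apply: rank_ext => x; rewrite rank_relabel.
rewrite (reindex _ (onW_bij _ (relabel_bij f fI))).
by apply: eq_bigr => r _; rewrite kendall_relabel.
Qed.

Lemma sum_rankings_rank (R : realType) (A : finType) (p : nat -> R) (x y : A) :
  \sum_(r : ranking A) p (rank r x) = \sum_(r : ranking A) p (rank r y).
Proof.
rewrite (reindex _ (onW_bij _ (relabel_bij _ (@perm_inj _ (tperm x y))))).
by apply: eq_bigr => r _; rewrite rank_relabel tpermL.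
Qed.

Lemma sum_rem (V : zmodType) (T : eqType) (F : T -> V) (s : seq T) x : x \in s ->
  \sum_(y <- rem x s) F y = \sum_(y <- s) F y - F x.
Proof. by move=> xs; rewrite [in RHS](big_rem x xs) /= addrAC subrr add0r. Qed.

(** * Positional scoring rules *)

Section Positional.
Context {R : realType} {A : finType}.
Implicit Types (r q t : ranking A) (x y z : A) (P : profile A).

(** Counting predecessors turns a strict total order into an injective key. *)
Lemma order_ranking (e : rel A) : irreflexive e -> transitive e ->
  (forall x y, x != y -> e x y || e y x) ->
  exists r : ranking A, forall x y, prefers r x y = e x y.
Proof.
move=> irr tr tot; pose k x := #|[set z | e z x]|.
have klt x y : e x y -> (k x < k y)%N.
  move=> exy; apply/proper_card/properP; split.
    by apply/fintype.subsetP => z; rewrite !inE => /tr; apply.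
  by exists x; rewrite inE ?irr.
have kI : injective k.
  move=> x y exy; apply/eqP/negPn/negP => /tot.
  by case/orP => /klt; rewrite exy ltnn.
exists (key_ranking k kI) => x y; rewrite prefers_key.
case exy: (e x y); first exact: klt.
have [->|/tot] := eqVneq x y; first by rewrite ltnn.
by rewrite exy /= => /klt yx; rewrite ltnNge ltnW.
Qed.

Lemma positional_rule_top t (p : nat -> R) P :
  (forall x y, prefers t x y -> positional_score p P y <= positional_score p P x) ->
  positional_rule t p P = t.
Proof.
move=> h; apply: lex_best_top; rewrite inE.
by apply/forallP => x; apply/forallP => y; apply/implyP/h.
Qed.

Lemma positional_ruleP t (p : nat -> R) P x y :
  prefers (positional_rule t p P) x y ->
  positional_score p P y <= positional_score p P x.
Proof.
pose S := positional_score p P.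
(* Ordering by score, with ties broken by [t], shows that the set of winning rankings is nonempty,
   so [lex_best] does not return its default. *)
pose e x y := (S y < S x) || (S x == S y) && prefers t x y.
have [|||r hr] := order_ranking e.
- by move=> z; rewrite /e ltxx prefers_irr andbF.
- move=> b a c; rewrite /e => /orP[h1|/andP[/eqP-> h1]] /orP[h2|/andP[/eqP e2 h2]].
  + by rewrite (lt_trans h2).
  + by rewrite -e2 h1.
  + by rewrite h2.
  + by rewrite e2 eqxx (prefers_trans _ _ _ _ h1 h2) orbT.
- move=> a b ab; rewrite /e (prefersN t a b ab).
  by case: ltgtP => //= _; apply: orbN.
have rW : r \in [set r | [forall x, forall y, prefers r x y ==> (S y <= S x)]].
  rewrite inE; apply/forallP => a; apply/forallP => b; rewrite hr /e.
  by apply/implyP => /orP[/ltW//|/andP[/eqP->]].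
have [] := lex_bestP t _ _ rW; rewrite inE => /forallP h _.
exact: implyP (forallP (h x) y).
Qed.

(** Keys 0 and [#|A|.+1] lie outside the range of [rank t]. This is the report by which the
    manipulator separates [a] from [b] as far as possible. *)
Lemma ranking_with_ends t a b : a != b ->
  exists q : ranking A, rank q a = 1%N /\ rank q b = #|A|.
Proof.
move=> ab; pose k x := if x == a then 0%N else if x == b then #|A|.+1 else rank t x.
have kI : injective k.
  move=> x y; rewrite /k; have := rank_bounds t x; have := rank_bounds t y.
  case: (eqVneq x a) => [xa|_]; case: (eqVneq y a) => [ya|_];
    case: (eqVneq x b) => [xb|_]; case: (eqVneq y b) => [yb|_] hx hy e;
    by [congruence | lia | apply: rank_inj e].
exists (key_ranking k kI); split.
  congr _.+1; apply/eqP; rewrite cards_eq0; apply/eqP/setP => x.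
  by rewrite !inE prefers_key /k eqxx.
rewrite /rank (_ : [set _ | _] = [set~ b]) ?cardsC1 ?prednK //.
  by apply/card_gt0P; exists a.
apply/setP => x; rewrite !inE prefers_key /k eqxx [b == a]eq_sym (negbTE ab).
have [->|_] := eqVneq x a; first by rewrite ab.
by have [_|_] := eqVneq x b; rewrite ?ltnn // ltnS rank_leq.
Qed.

(* All rankings occur exactly once, so every alternative has the same score and
   t wins by tie-breaking; the voter with ranking rev t then breaks one tie. *)
Lemma positional_incentive_ratio t (p : nat -> R) :
  (3 <= #|A|)%N -> positional_scoring_function #|A| p ->
  incentive_ratio R (positional_rule t p) = +oo%E.
Proof.
move=> m3 [pmono p1m]; set m := #|A| in m3 pmono p1m.
have ple k l : (0 < k)%N -> (k <= l <= m)%N -> p l <= p k.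
  move=> k0; elim: l => [|l IH]; first by case: k k0.
  case/andP; rewrite leq_eqVlt => /orP[/eqP->//|kl] lm.
  apply: le_trans (_ : p l.+1 <= p l) (IH _); last lia.
  by apply: pmono; lia.
(* If [p 2] exceeds [p m], the first gap is smaller than the total gap; otherwise [p 2], [p 3] and
   [p m] coincide and the second gap is 0. *)
have [j [jm pj]] : exists j, (0 < j < m)%N /\ p j - p j.+1 < p 1%N - p m.
  have [p2m|p2m] := ltP (p m) (p 2).
    by exists 1%N; split; [lia | rewrite ltrD2l ltrN2].
  exists 2; split; first lia.
  have := ple 2 3 isT m3; have := ple 3 m isT _; rewrite m3 leqnn => /(_ isT); lra.
(* [a] and [b] are neighbours in the truthful vote, and [t] orders them the other way. Moving them
   to the extremes makes [a] score strictly more than [b]. *)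
have /(rank_surj (rev_ranking t))[a ra] : (0 < j <= #|A|)%N by rewrite -/m; lia.
have /(rank_surj (rev_ranking t))[b rb] : (0 < j.+1 <= #|A|)%N by rewrite -/m; lia.
have ab : a != b by apply: contra_eq_neq rb => <-; rewrite ra; lia.
have tba : prefers t b a by rewrite -prefers_rev -ltn_rank ra rb.
have [q [qa qb]] := ranking_with_ends t a b ab.
have [P [i [Pi sumP sumPq]]] :=
  @list_profile R A (rev_ranking t) (rem (rev_ranking t) (index_enum (ranking A))).
have mem_t : rev_ranking t \in index_enum (ranking A) by rewrite mem_index_enum.
have fP : positional_rule t p P = t.
  apply: positional_rule_top => x y _.
  rewrite /positional_score !(sumP (fun r => p (rank r _))).
  by rewrite !big_cons !sum_rem // (sum_rankings_rank R A p x y); lra.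
have fPq : positional_rule t p (deviate i q) != t.
  apply: contraTneq tba => ft; apply/negP; rewrite -{1}ft => /positional_ruleP.
  rewrite /positional_score !(sumPq q (fun r => p (rank r _))).
  rewrite !big_cons !sum_rem // (sum_rankings_rank R A p a b) qa qb ra rb.
  apply/negP; rewrite -ltNge -/m; lra.
apply/eqP; rewrite -leye_eq; apply: le_trans (incentive_ratio_ge _ P i q).
(* The truthful outcome is the reversal of the voter's ranking, so the denominator is 0. *)
by rewrite Pi fP /utility_ratio !utility_eq0 rev_rankingK eqxx (negbTE fPq).
Qed.

End Positional.

(** * Transpositions of neighbours *)

Section AdjacentSwap.
Context {A : finType}.
Implicit Types (r q t : ranking A) (x y z : A).

(** No rank lies strictly between [k] and [k.+1], so exchanging these two keys affects no other
    comparison. *)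
Lemma adjacent_swap t k : (0 < k < #|A|)%N ->
  exists u a b, [/\ rank t a = k, rank t b = k.+1 & discord t u = [set (a, b)]].
Proof.
move=> kA.
have /(rank_surj t)[a ra] : (0 < k <= #|A|)%N by lia.
have /(rank_surj t)[b rb] : (0 < k.+1 <= #|A|)%N by lia.
pose f x := if x == a then k.+1 else if x == b then k else rank t x.
have fa x : (rank t x == k) = (x == a) by rewrite -ra (inj_eq (rank_inj t)).
have fb x : (rank t x == k.+1) = (x == b) by rewrite -rb (inj_eq (rank_inj t)).
have fI : injective f.
  move=> x y; rewrite /f; have := fa x; have := fa y; have := fb x; have := fb y.
  case: (eqVneq x a) => [xa|_]; case: (eqVneq y a) => [ya|_];
    case: (eqVneq x b) => [xb|_]; case: (eqVneq y b) => [yb|_] h1 h2 h3 h4 e;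
    by [congruence | lia | apply: (rank_inj t)].
exists (key_ranking f fI), a, b; split=> //; apply/setP => -[x y].
rewrite !inE /= prefers_key -ltn_rank xpair_eqE /f.
have := fa x; have := fa y; have := fb x; have := fb y.
case: (eqVneq x a) => [->|_]; case: (eqVneq y a) => [->|_];
  case: (eqVneq x b) => [xb|_]; case: (eqVneq y b) => [yb|_] //= h1 h2 h3 h4;
  rewrite ?ra ?xb ?yb ?rb; lia.
Qed.

Lemma kendall_discord1 r q x y : discord r q = [set (x, y)] -> kendall r q = 1%N.
Proof. by move=> h; rewrite -card_discord h cards1. Qed.

End AdjacentSwap.

(** * Distance rules other than the Kemeny rule *)

Section NonKemeny.
Context {R : realType} {A : finType}.
Implicit Types (r q t : ranking A) (x y z : A) (P : profile A).

Lemma utility_ratio1 (v : R) : utility_ratio v 1 = v%:E.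
Proof. by rewrite /utility_ratio oner_eq0 divr1. Qed.

(* The truthful profile has two copies of every ranking except t and rev t, so
   up to a constant the cost of q is -2 (s d + s (M - d)) with d the distance
   from t to q; by strict convexity only t and rev t are optimal.  A voter at
   distance one from rev t then tips the balance by reporting rev t. *)
Lemma nonlinear_incentive_ratio t (s : nat -> R) : (3 <= #|A|)%N ->
  distance_scoring_function #|A| s ->
  s 1%N - s 0%N < s 'C(#|A|, 2) - s 'C(#|A|, 2).-1 ->
  (('C(#|A|, 2)%:R - 1)%:E <= incentive_ratio R (distance_rule t s))%E.
Proof.
move=> m3 sd; set M := 'C(#|A|, 2) => sM.
have M3 : (3 <= M)%N by exact: (leq_bin2l 2 m3).
have /(adjacent_swap t)[u [a [b [_ _ dtu]]]] : (0 < 1 < #|A|)%N by lia.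
have tu1 : kendall t u = 1%N := kendall_discord1 _ _ _ _ dtu.
have t_rev : t != rev_ranking t by rewrite -kendall_eq0 kendall_revr kendallxx; lia.
set rt := rev_ranking t in t_rev *.
pose L := [seq r <- index_enum (ranking A) | (r != t) && (r != rt)].
have sumL F : \sum_(r <- L) F r = \sum_r F r - F t - F rt :> R.
  rewrite big_filter [in RHS](bigD1 t) //= [in RHS](bigD1 rt) 1?eq_sym //=; ring.
(* At distance [M - 1] from [t] and 1 from [rt], this ranking is in the list, and one copy becomes
   the manipulator. *)
have uL : rev_ranking u \in L ++ L.
  rewrite mem_cat orbb mem_filter mem_index_enum andbT.
  rewrite -(kendall_eq0 (rev_ranking u) t) kendall_revl kendallC tu1 -/M.
  rewrite (inj_eq (can_inj rev_rankingK)) -kendall_eq0 kendallC tu1; lia.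
have [P [i [Pi sumP sumPq]]] :=
  @list_profile R A (rev_ranking u) (rem (rev_ranking u) (L ++ L)).
(* By symmetry this sum is the same around every ranking [q]. *)
pose T := \sum_r s (kendall r t).
have costE q : distance_cost s P q =
    2 * (T - s (kendall t q) - s (M - kendall t q)%N).
  rewrite /distance_cost (sumP (fun r => s (kendall r q))) big_cons sum_rem //.
  rewrite big_cat /= sumL (sum_rankings_kendall _ _ s q t) -/T !kendall_revl -/M; ring.
have cost'E q : distance_cost s (deviate i rt) q = distance_cost s P q
    + s (M - kendall t q)%N - s (M - kendall u q)%N.
  have := distance_cost_deviate s P i rt q.
  by rewrite Pi !kendall_revl -/M; lra.
have strict d : (0 < d < M)%N -> s d + s (M - d)%N < s 0%N + s M.
  exact: score_strict sd d sM.
have kM q : (kendall t q <= M)%N := kendall_leq t q.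
have fP : distance_rule t s P = t.
  apply: distance_rule_top => q; rewrite !costE kendallxx subn0.
  have [d0|d0] := posnP (kendall t q); first by rewrite d0 subn0.
  have [dM|dM] := eqVneq (kendall t q) M; first by rewrite dM subnn; lra.
  by have := strict (kendall t q); rewrite d0 ltn_neqAle dM kM => /(_ isT); lra.
have fP' : distance_rule t s (deviate i rt) = rt.
  apply: distance_rule_strict => q qrt; rewrite !cost'E !costE.
  rewrite !kendall_revr kendallxx kendallC tu1 subn0 subnn subKn; last by rewrite -/M; lia.
  have dM : (kendall t q < M)%N by rewrite ltn_neqAle kM kendall_eq_max qrt.
  have [d0|d0] := posnP (kendall t q).
    have tq : t = q by apply/eqP; rewrite -kendall_eq0 d0.
    rewrite d0 -tq kendallC tu1 subn0.
    have : s 0%N < s 1%N by apply: (score_lt _ _ sd); lia.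
    have : s (M - 1)%N < s M by apply: (score_lt _ _ sd); rewrite -/M; lia.
    lra.
  (* One strict inequality for [d] is split off the cost difference. The rest is nonnegative by
     convexity, as [u] is at distance at least [d - 1] from [q]. *)
  have le2 : s (kendall t q) + s (M - kendall u q)%N <= s M + s 1%N.
    have := kendall_triangle u t q; rewrite tu1.
    have := kendall_leq u q; rewrite -/M; move: d0 dM.
    move: (kendall t q) (kendall u q) => d e d0 dM eM de.
    have h1 : s (M - e)%N <= s (M + 1 - d)%N by apply: (score_le _ _ sd); rewrite -/M; lia.
    have := score_convex _ _ sd 1 (M + 1 - d) (d - 1).
    rewrite -/M (_ : (1 + (d - 1) = d)%N); last lia.
    rewrite (_ : (M + 1 - d + (d - 1) = M)%N); last lia.
    by move=> h; have {}h := h ltac:(lia) ltac:(lia); lra.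
  by have := strict (kendall t q); rewrite d0 dM => /(_ isT); lra.
(* The manipulator's utility rises from 1 at [t] to [M - 1] at [rt]. *)
have := @incentive_ratio_ge R A (distance_rule t s) P i rt.
rewrite Pi fP fP'.
rewrite !utility_revl kendall_revr (kendallC u t) tu1 utility_ratio1 natrB //.
by rewrite -/M; lia.
Qed.

(** The scores are affine with positive slope, so both costs have the same minimizers. *)
Lemma affine_distance_rule t (s : nat -> R) :
  distance_scoring_function #|A| s -> (2 <= #|A|)%N ->
  s 'C(#|A|, 2) - s 'C(#|A|, 2).-1 <= s 1%N - s 0%N ->
  distance_rule t s = kemeny_rule R t.
Proof.
move=> sd m2 sM; apply: funext => P; rewrite /kemeny_rule /distance_rule.
congr lex_best; apply/setP => r; rewrite !inE; apply: eq_forallb => q.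
have g0 : 0 < s 1%N - s 0%N by rewrite subr_gt0 (score_lt _ _ sd) //= bin_gt0.
have costE r' : distance_cost s P r' = \sum_(i : voters P) s 0%N +
    (s 1%N - s 0%N) * distance_cost (fun n => n%:R) P r'.
  rewrite /distance_cost mulr_sumr -big_split /=; apply: eq_bigr => i _.
  by rewrite (score_affine _ _ sd _ sM (kendall_leq _ _)) mulrC.
by rewrite !costE lerD2l ler_pM2l.
Qed.

Lemma non_kemeny_incentive_ratio_ge t (s : nat -> R) : (3 <= #|A|)%N ->
  distance_scoring_function #|A| s -> distance_rule t s <> kemeny_rule R t ->
  (('C(#|A|, 2)%:R - 1)%:E <= incentive_ratio R (distance_rule t s))%E.
Proof.
move=> m3 sd nk; apply: nonlinear_incentive_ratio => //.
by rewrite ltNge; apply/negP => /(affine_distance_rule t _ sd (ltnW m3)).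
Qed.

End NonKemeny.

(** * Kemeny rule: McGarvey profiles and the path *)

Section Kemeny.
Context {A : finType}.
Implicit Types (r q t : ranking A) (x y z : A).

Lemma discordC r q x y : discord r q = [set (x, y)] -> discord q r = [set (y, x)].
Proof.
move=> /setP h; apply/setP => -[u v]; have := h (v, u).
by rewrite !inE /= !xpair_eqE [(u == y) && _]andbC => <-; apply: andbC.
Qed.

(* McGarvey's construction: the two rankings agree only on the pair {x, y}. *)
Lemma mcgarvey_pair t x y : x != y -> exists r1 r2 : ranking A, forall q,
  (kendall r1 q + kendall r2 q)%N = ('C(#|A|, 2).-1 + (prefers q y x).*2)%N.
Proof.
(* [x] and [y] take the top two positions of [r], so they can be swapped as neighbours; the second
   vote is the reversal of the result. *)
move=> xy; pose f z := if z == x then 0%N else if z == y then 1%N else (rank t z).+1.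
have fI : injective f.
  move=> z z'; rewrite /f; have := rank_bounds t z; have := rank_bounds t z'.
  case: (eqVneq z x) => [zx|_]; case: (eqVneq z' x) => [zx'|_];
    case: (eqVneq z y) => [zy|_]; case: (eqVneq z' y) => [zy'|_] h h' e;
    by [congruence | lia | apply: (rank_inj t); lia].
pose r := key_ranking f fI.
have rx : rank r x = 1%N.
  congr _.+1; apply/eqP; rewrite cards_eq0; apply/eqP/setP => z.
  by rewrite !inE prefers_key /f eqxx.
have ry : rank r y = 2%N.
  apply: (congr1 S (_ : _ = 1%N)); rewrite -(cards1 x); apply: eq_card => z.
  rewrite !inE prefers_key /f eqxx [y == x]eq_sym (negbTE xy).
  by case: (eqVneq z x) => //; case: (eqVneq z y).
have A2 : (1 < #|A|)%N by have := rank_leq r y; rewrite ry.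
have /(adjacent_swap r)[u [a [b [ra rb dru]]]] : (0 < 1 < #|A|)%N by [].
have ax : a = x by apply: (rank_inj r); rewrite ra rx.
have bY : b = y by apply: (rank_inj r); rewrite rb ry.
rewrite ax bY in dru; exists r, (rev_ranking u) => q; rewrite kendall_revl.
have M0 : (0 < 'C(#|A|, 2))%N by rewrite bin_gt0.
have := kendall_leq u q; have := kendall_leq r q.
case qyx: (prefers q y x).
  by rewrite (kendall_swap r u q x y dru qyx) /=; lia.
have qxy : prefers q x y by rewrite prefersN 1?eq_sym // qyx.
by rewrite (kendall_swap u r q y x (discordC _ _ _ _ dru) qxy) /=; lia.
Qed.

(** Adding one pair of votes per entry makes the Kemeny cost count violated edges; repetitions in
    [E] act as weights. *)
Lemma mcgarvey t (E : seq (A * A)) : (forall e, e \in E -> e.1 != e.2) ->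
  exists (s : seq (ranking A)) c, forall q,
    (\sum_(r <- s) kendall r q = c + (\sum_(e <- E) prefers q e.2 e.1).*2)%N.
Proof.
elim: E => [_|e E IH hE]; first by exists [::], 0%N => q; rewrite !big_nil.
have [|s [c hs]] := IH; first by move=> e' e'E; apply: hE; rewrite inE e'E orbT.
have [r1 [r2 h12]] := mcgarvey_pair t e.1 e.2 (hE e (mem_head _ _)).
exists (r1 :: r2 :: s), ('C(#|A|, 2).-1 + c)%N => q.
by rewrite !big_cons addnA h12 hs; lia.
Qed.

(* Vertices carry the labels 0, ..., m - 1 of a path.  t lists them as
   1 0 3 2 5 4 ..., and w reverses t except that every odd label still precedes
   its even neighbours. *)
Section Path.
Variables (t w : ranking A) (lab : A -> nat).
Let m := #|A|.
Hypothesis lab_inj : injective lab.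
Hypothesis lab_lt : forall x, (lab x < m)%N.
Hypothesis tE : forall x y, prefers t x y =
  (lab x + (~~ odd (lab x)).*2 < lab y + (~~ odd (lab y)).*2)%N.
Hypothesis wE : forall x y, prefers w x y =
  (lab y + (odd (lab y)).*2 < lab x + (odd (lab x)).*2)%N.

(** Path edges are directed as [t], and also [w], orders their ends. *)
Definition path_edge x y :=
  prefers t x y && ((lab x == (lab y).+1) || (lab y == (lab x).+1)).
Definition path_far x y := ((lab x).+1 < lab y)%N || ((lab y).+1 < lab x)%N.
Definition path_triple (e : A * A * A) :=
  [&& path_edge e.1.1 e.1.2, path_far e.2 e.1.1 & path_far e.2 e.1.2].

(** The second clause is the forcing relation of transitive orientations: [z x] and [z y] are edges
    of the complement of the path, [x y] is not. *)
Definition consistent q :=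
  (forall x y, path_edge x y -> prefers q x y) /\
  (forall x y z, path_triple (x, y, z) -> prefers q z x = prefers q z y).

Lemma consistent_t : consistent t.
Proof.
split=> [x y /andP[]//|x y z]; rewrite /path_triple /path_edge /path_far !tE /=.
lia.
Qed.

Lemma consistent_w : consistent w.
Proof.
by split=> [x y|x y z]; rewrite /path_triple /path_edge /path_far !tE !wE /=; lia.
Qed.

(** Each triple contributes a Condorcet cycle; the path edges listed separately make reversing one
    of them suboptimal. *)
Definition path_edges : seq (A * A) :=
  [seq e <- index_enum (A * A)%type | path_edge e.1 e.2] ++
  flatten [seq [:: (e.1.1, e.1.2); (e.1.2, e.2); (e.2, e.1.1)] |
           e <- index_enum (A * A * A)%type & path_triple e].

Definition path_cost q := (\sum_(e <- path_edges) prefers q e.2 e.1)%N.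

Definition path_min := (\sum_(e | path_triple e) 1)%N.

Lemma path_costE q : path_cost q =
  (\sum_(e | path_edge e.1 e.2) prefers q e.2 e.1 + \sum_(e | path_triple e)
    (prefers q e.1.2 e.1.1 + (prefers q e.2 e.1.2 + prefers q e.1.1 e.2)))%N.
Proof.
rewrite /path_cost big_cat big_filter big_flatten big_map big_filter /=.
by congr addn; apply: eq_bigr => e _; rewrite !big_cons big_nil addn0.
Qed.

Lemma path_edges_neq e : e \in path_edges -> e.1 != e.2.
Proof.
rewrite mem_cat mem_filter => /orP[/andP[/andP[/prefers_neq]]//|].
case/flattenP => _ /mapP[[[x y] z] + ->]; rewrite mem_filter /path_triple /path_far /=.
case/andP => /and3P[/andP[/prefers_neq xy _] zx zy] _; rewrite !inE.
have zx' : z != x by apply: contraTneq zx => ->; lia.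
have zy' : y != z by apply: contraTneq zy => ->; lia.
by case/or3P => /eqP->.
Qed.

(** A transitive order cannot follow a whole cycle. *)
Lemma triple_cost_ge q e : path_triple e ->
  (1 <= prefers q e.1.2 e.1.1 + (prefers q e.2 e.1.2 + prefers q e.1.1 e.2))%N.
Proof.
case: e => -[x y] z; rewrite /path_triple /path_far /=.
case/and3P => /andP[/prefers_neq xy _] zx zy.
have zx' : z != x by apply: contraTneq zx => ->; lia.
have zy' : y != z by apply: contraTneq zy => ->; lia.
rewrite (prefersN q x y xy) (prefersN q y z zy').
case xy1: (prefers q x y) => //; case yz1: (prefers q y z) => //=.
by rewrite (prefers_trans _ _ _ _ xy1 yz1).
Qed.

Lemma path_cost_ge q : (path_min <= path_cost q)%N.
Proof.
rewrite path_costE; apply: leq_trans (leq_addl _ _).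
by apply: leq_sum => e; apply: triple_cost_ge.
Qed.

(** The minimum means that no path edge is violated and each cycle is violated once; with [x] above
    [y], the latter puts [z] on the same side of both. *)
Lemma path_costP q :
  reflect (consistent q) (path_cost q == path_min).
Proof.
apply: (iffP eqP) => [|[hE hT]].
  rewrite path_costE /path_min => h.
  have [le2 eq2] : (\sum_(e | path_triple e) 1 <= \sum_(e | path_triple e)
    (prefers q e.1.2 e.1.1 + (prefers q e.2 e.1.2 + prefers q e.1.1 e.2)) ?= iff
    [forall (e | path_triple e), 1 == prefers q e.1.2 e.1.1 +
      (prefers q e.2 e.1.2 + prefers q e.1.1 e.2)])%N.
    by apply: leqif_sum => e he; apply: leqif_eq; apply: triple_cost_ge.
  have hE : forall x y, path_edge x y -> prefers q x y.
    move=> x y exy; have : (\sum_(e | path_edge e.1 e.2) prefers q e.2 e.1 == 0)%N.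
      by move: le2 h; rewrite /=; lia.
    rewrite sum_nat_eq0 => /forall_inP/(_ (x, y) exy); rewrite eqb0 /= => nyx.
    by rewrite prefersN ?nyx //; case/andP: exy => /prefers_neq; rewrite eq_sym.
  split=> // x y z xyz.
  have : [forall (e | path_triple e), 1 == prefers q e.1.2 e.1.1 +
      (prefers q e.2 e.1.2 + prefers q e.1.1 e.2)]%N.
    by rewrite -eq2; move: le2 h; rewrite /=; lia.
  move=> /forall_inP/(_ _ xyz) /=.
  case/and3P: xyz => /= /hE qxy zx _; rewrite (prefers_asym _ _ _ qxy).
  have zx' : z != x by apply: contraTneq zx => ->; rewrite /path_far; lia.
  by rewrite (prefersN q z x zx'); do 2!case: (prefers q z _).
rewrite path_costE big1 => [|e /hE/prefers_asym-> //].
apply: eq_bigr => -[[x y] z] /= xyz.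
rewrite -(hT _ _ _ xyz); case/and3P: xyz => /= /hE qxy zx _.
have zx' : z != x by apply: contraTneq zx => ->; rewrite /path_far; lia.
by rewrite (prefers_asym _ _ _ qxy) (prefersN q z x zx'); case: (prefers q z x).
Qed.

Hypothesis m4 : (4 <= m)%N.

Lemma lab_surj i : (i < m)%N -> exists x, lab x = i.
Proof.
move=> im; pose f x : 'I_m := Ordinal (lab_lt x).
have fI : injective f by move=> x y [/lab_inj].
have [g _ gK] := inj_card_bij fI (eq_leq (card_ord _)).
by exists (g (Ordinal im)); have [] := gK (Ordinal im).
Qed.

(* Consistency links the orientation of {z, x} to that of {z, y} for adjacent x
   and y both far from z, and these links connect all far pairs. *)
Lemma consistent_eq q : consistent q -> q = t \/ q = w.
Proof.
case=> hE hT.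
have adj x y z : lab y = (lab x).+1 -> path_far z x -> path_far z y ->
    prefers q z x = prefers q z y.
  move=> xy zx zy; have neq : x != y by apply: contra_eq_neq xy => ->; lia.
  have := prefersN t x y neq; case txy: (prefers t x y) => /= tyx.
    by apply: hT; rewrite /path_triple /path_edge /= txy xy eqxx orbT zx zy.
  by apply/esym/hT; rewrite /path_triple /path_edge /= tyx xy eqxx zx zy.
have [x0 _] := lab_surj 0 ltac:(lia).
pose v i := odflt x0 [pick x | lab x == i].
have vE i : (i < m)%N -> lab (v i) = i.
  by move=> /lab_surj[x <-]; rewrite /v; case: pickP => [y /eqP|/(_ x)/eqP].
have vK x : v (lab x) = x by apply: lab_inj; rewrite vE.
pose o i l := prefers q (v i) (v l).
have oN i l : (i < m)%N -> (l < m)%N -> i != l -> o l i = ~~ o i l.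
  by move=> im lm il; apply: prefersN; apply: contra_neq il => e; rewrite -(vE i) // e vE.
(* [or] moves the right end of a far pair and [ol] the left end, until every far pair is linked to
   the two ends of the path. *)
have or i l : (i.+1 < l)%N -> (l.+1 < m)%N -> o i l = o i l.+1.
  by move=> il lm; apply: adj; rewrite /path_far !vE //; lia.
have ol i l : (i.+2 < l)%N -> (l < m)%N -> o i l = o i.+1 l.
  move=> il lm; rewrite (oN l i) ?(oN l i.+1); try lia.
  by congr (~~ _); apply: adj; rewrite /path_far !vE //; lia.
have o_max i l : (i.+1 < l)%N -> (l < m)%N -> o i l = o i m.-1.
  move=> il lm; have -> : m.-1 = (l + (m.-1 - l))%N by lia.
  have : (l + (m.-1 - l) < m)%N by lia.
  elim: (m.-1 - l)%N => [|k IH] h; first by rewrite addn0.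
  by rewrite addnS -or ?IH //; lia.
have o_const i l : (i.+1 < l)%N -> (l < m)%N -> o i l = o 0%N m.-1.
  move=> il lm; rewrite (o_max i l) //; have : (i.+1 < m.-1)%N by lia.
  by elim: i {il} => [//|i IH] h; rewrite -ol ?IH //; lia.
have qE x y : ((lab x).+1 < lab y)%N -> prefers q x y = o 0%N m.-1.
  by move=> xy; rewrite -(o_const (lab x) (lab y)) // /o !vK.
case b : (o 0%N m.-1); [left|right]; apply/esym/ranking_ext => x y.
  have [far|nfar] := boolP (path_far x y); last first.
    move=> txy; apply: hE; rewrite /path_edge txy /=.
    have := inj_eq lab_inj x y; rewrite (negbTE (prefers_neq _ _ _ txy)).
    by move: nfar; rewrite /path_far; lia.
  case/orP: far => [xy|yx]; first by rewrite qE.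
  by rewrite tE; lia.
have [far|nfar] := boolP (path_far x y); last first.
  move=> wxy; apply: hE; rewrite /path_edge.
  have := inj_eq lab_inj x y; rewrite (negbTE (prefers_neq _ _ _ wxy)).
  by move: nfar wxy; rewrite /path_far tE wE; lia.
case/orP: far => [xy|yx]; first by rewrite wE; lia.
by rewrite (prefersN q) ?qE ?b //; apply: contraTneq yx => ->; lia.
Qed.

(** The pairs counted are those on which [t] and [w] agree: path edges with the odd label first,
    each determined by its smaller label. *)
Lemma kendall_path_rev : (kendall t (rev_ranking w) <= m.-1)%N.
Proof.
rewrite -card_discord; pose f (e : A * A) : 'I_m.-2.+1 := inord (minn (lab e.1) (lab e.2)).
have -> : m.-1 = #|'I_m.-2.+1| by rewrite card_ord; lia.
apply: (@leq_card_in _ _ f) => -[x y] [x' y'].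
have agree a b : prefers t a b && prefers w a b ->
    odd (lab a) /\ (lab a = (lab b).+1 \/ lab b = (lab a).+1).
  by rewrite tE wE; lia.
have small a b : lab a = (lab b).+1 \/ lab b = (lab a).+1 ->
    (minn (lab a) (lab b) < m.-2.+1)%N.
  by have := lab_lt a; have := lab_lt b; lia.
rewrite !inE /= !prefers_rev => /agree[ox adj] /agree[ox' adj'] /(congr1 val).
rewrite /f /= !inordK ?small // => e.
have ex : lab x = lab x'.
  by case: adj adj' => [xy|yx] [xy'|yx']; move: ox ox' e; lia.
by congr (_, _); apply: lab_inj => //; case: adj adj' => [xy|yx] [xy'|yx']; lia.
Qed.

End Path.

(** * Kemeny rule: the manipulation *)

Lemma path_labelling t : (4 <= #|A|)%N -> exists (lab : A -> nat) (w : ranking A),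
  [/\ injective lab, forall x, (lab x < #|A|)%N,
      forall x y, prefers t x y =
        (lab x + (~~ odd (lab x)).*2 < lab y + (~~ odd (lab y)).*2)%N,
      forall x y, prefers w x y =
        (lab y + (odd (lab y)).*2 < lab x + (odd (lab x)).*2)%N &
      forall a b, rank t a = 2%N -> rank t b = 3%N -> prefers w b a].
Proof.
(* Pairs of consecutive positions get labels 1 0, 3 2, and so on; for odd [#|A|] the minimum gives
   the unpaired last position the last label. *)
move=> m4; pose lab x := let k := (rank t x).-1 in
  if odd k then k.-1 else minn k.+1 #|A|.-1.
have labE x : lab x = if odd (rank t x) then minn (rank t x) #|A|.-1 else (rank t x).-2.
  by rewrite /lab; have := rank_bounds t x; case: (rank t x) => //= k _; case: odd.
have lab_lt x : (lab x < #|A|)%N by rewrite labE; have := rank_bounds t x; case: ifP; lia.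
have lab_inj : injective lab.
  move=> x y; rewrite !labE; have := rank_bounds t x; have := rank_bounds t y.
  by do 2!case: ifP; move=> h1 h2 h3 h4 h5; apply: (rank_inj t); lia.
(* The offset 2 keeps the truncated subtraction faithful. *)
pose k x := (#|A| + 2 - (lab x + (odd (lab x)).*2))%N.
have kI : injective k.
  by move=> x y; rewrite /k => e; apply: lab_inj; have := lab_lt x; have := lab_lt y; lia.
have wE x y : prefers (key_ranking k kI) x y =
    (lab y + (odd (lab y)).*2 < lab x + (odd (lab x)).*2)%N.
  by rewrite prefers_key /k; have := lab_lt x; have := lab_lt y; lia.
exists lab, (key_ranking k kI); split=> // [x y|a b ra rb].
  rewrite -ltn_rank !labE; have := rank_bounds t x; have := rank_bounds t y.
  by do 2!case: ifP; lia.
have lb : minn 3 #|A|.-1 = 3%N by lia.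
by rewrite wE !labE ra rb /= lb.
Qed.

(** The votes [u] and [rev_ranking u] cancel, leaving [t] and [w] tied as optima; replacing
    [rev_ranking u] by [w] breaks the tie. *)
Lemma kemeny_incentive_ratio_ge (R : realType) t : (4 <= #|A|)%N ->
  (('C(#|A|, 2)%:R - #|A|%:R)%:E <= incentive_ratio R (kemeny_rule R t))%E.
Proof.
move=> m4; have [lab [w [lab_inj lab_lt tE wE wba]]] := path_labelling t m4.
(* Positions 2 and 3 of [t] carry labels 0 and 3, a pair that [w] orders oppositely, so swapping
   them moves [t] closer to [w]. *)
have /(adjacent_swap t)[u [a [b [ra rb dtu]]]] : (0 < 2 < #|A|)%N by lia.
have tu1 := kendall_discord1 _ _ _ _ dtu.
have tw := kendall_swap _ _ _ _ _ dtu (wba _ _ ra rb).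
have [s [c hs]] := mcgarvey t _ (path_edges_neq t lab).
have [P [i [Pi sumP sumPq]]] := @list_profile R A (rev_ranking u) (u :: s).
set N := path_min t lab.
have B_t : path_cost t lab t = N by apply/eqP/path_costP/consistent_t.
have B_w : path_cost t lab w = N by apply/eqP/path_costP/consistent_w.
have B_ge q : (N <= path_cost t lab q)%N := path_cost_ge t lab q.
have fP : kemeny_rule R t P = t.
  apply: distance_rule_top => q.
  rewrite /distance_cost !(sumP (fun r => (kendall r _)%:R)) -!natr_sum ler_nat.
  rewrite !big_cons !hs !kendall_revl -!/(path_cost _ _ _) B_t.
  by have := B_ge q; have := kendall_leq u q; have := kendall_leq u t; lia.
have fP' : kemeny_rule R t (deviate i w) = w.
  apply: distance_rule_strict => q qw.
  rewrite /distance_cost !(sumPq w (fun r => (kendall r _)%:R)) -!natr_sum ltr_nat.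
  rewrite !big_cons !hs -!/(path_cost _ _ _) B_w kendallxx.
  (* Off the minimum of [path_cost] the triangle inequality suffices; at the minimum only [q = t]
     remains. *)
  have := kendall_triangle q u w; rewrite (kendallC q w).
  have := B_ge q; rewrite leq_eqVlt => /orP[/eqP BN|]; last lia.
  have /consistent_eq : consistent t lab q by apply/path_costP; rewrite -BN.
  move=> /(_ w lab_inj lab_lt tE wE m4) [->|e]; last by rewrite e eqxx in qw.
  by rewrite B_t (kendallC w t) (kendallC u t) tu1; lia.
have := @incentive_ratio_ge R A (kemeny_rule R t) P i w.
rewrite Pi fP fP' !utility_revl (kendallC u t) tu1 utility_ratio1.
apply: le_trans; rewrite lee_fin lerBlDr -natrD ler_nat.
(* The distance from [t] to [w] is at least [C(m, 2) - (m - 1)], and [u] is one step nearer to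
   [w]. *)
have := kendall_path_rev t w lab lab_inj lab_lt tE wE m4.
by rewrite kendall_revr; lia.
Qed.

End Kemeny.

Theorem theorem3 (R : realType) :
  (forall (m : nat) (A : finType) (t : ranking A), #|A| = m -> (4 <= m)%N ->
     (('C(m, 2)%:R - m%:R)%:E <= incentive_ratio R (kemeny_rule R t))%E /\
     (incentive_ratio R (kemeny_rule R t) <= ('C(m, 2)%:R)%:E)%E) /\
  (forall (m : nat) (A : finType) (t : ranking A) (s : nat -> R),
     #|A| = m -> (3 <= m)%N ->
     distance_scoring_function m s ->
     distance_rule t s <> kemeny_rule R t ->
     (('C(m, 2)%:R - 1)%:E <= incentive_ratio R (distance_rule t s))%E /\
     (incentive_ratio R (distance_rule t s) <= ('C(m, 2)%:R)%:E)%E) /\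
  (forall (m : nat) (A : finType) (t : ranking A) (p : nat -> R),
     #|A| = m -> (3 <= m)%N ->
     positional_scoring_function m p ->
     incentive_ratio R (positional_rule t p) = +oo%E).
Proof.
split=> [m A t <- m4|]; first split.
- exact: kemeny_incentive_ratio_ge.
- apply: distance_incentive_le; last lia.
  split=> [x|[|[|x]]] //; rewrite ?ltr_nat; first lia.
  by rewrite subn1 subn2 /= -!natr1; lra.
split=> [m A t s <- m3 sd nk|m A t p <-]; last exact: positional_incentive_ratio.
split; first exact: non_kemeny_incentive_ratio_ge.
by apply: distance_incentive_le => //; lia.
Qed.
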